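(* Let $\mathcal{B}=[0,1]^2$ and let the moves $\mathbf{m}_1,\mathbf{m}_2$ have real slopes $m_1,m_2$ with $0<m_1<1$ and $m_2<-1$. Let \[\mathcal{O}=\left\{\left(\tfrac{m_1-1}{m_1+m_2},0\right),\left(1,\tfrac{m_1(1+m_2)}{m_1+m_2}\right),\left(\tfrac{1+m_2}{m_1+m_2},1\right),\left(0,\tfrac{m_2(1-m_1)}{m_1+m_2}\right)\right\}.\] Then $\mathcal{O}$ is the only finite orbit in $\partial\mathcal{B}$. Moreover, if $T=(\mathbf{b}_n)$ is an extended trajectory disjoint from $\mathcal{O}$, then in each direction (as $n$ increases and as $n$ decreases) $T$ either stops at a corner of $\mathcal{B}$ or converges to $\mathcal{O}$, in the sense that $\mathcal{O}$ is the $\omega$-limit set (set of accumulation points) of $T$ in that direction.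
   Context: Dynamics on a bounded convex region $\mathcal{R}$ (here $\mathcal{R}=[0,1]^2$) with two nonparallel move vectors $\mathbf{m}_1,\mathbf{m}_2$: for $r\in\{1,2\}$ the antipode map $s_r:\partial\mathcal{R}\to\partial\mathcal{R}$ sends $\mathbf{b}$ to itself if the line $\{\mathbf{b}+\lambda\mathbf{m}_r:\lambda\in\mathbb{R}\}$ misses the interior $\mathcal{R}^\circ$, and otherwise to the other point of intersection of that line with $\partial\mathcal{R}$. An extended trajectory is a maximal sequence $(\mathbf{b}_n)_{n\in I}$, $I\subseteq\mathbb{Z}$ an interval (possibly infinite in either direction), of points of $\partial\mathcal{R}$ with $\mathbf{b}_{n+1}=s_{r_n}(\mathbf{b}_n)\ne\mathbf{b}_n$ where $r_n\in\{1,2\}$ alternates ($r_{n+1}\ne r_n$); it stops at an end when the next antipode map in the alternation fixes the point. The orbit of $\mathbf{b}\in\partial\mathcal{R}$ is the set of points of the extended trajectory through $\mathbf{b}$; it is finite if this set is finite. *)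

(* Defs.v *)
From HB Require Import structures.
From mathcomp Require Import all_boot all_order all_algebra.
From mathcomp Require Import all_classical all_reals all_analysis.

Set Implicit Arguments.
Unset Strict Implicit.
Unset Printing Implicit Defensive.
Import Order.TTheory GRing.Theory Num.Theory.
Import numFieldNormedType.Exports.
Local Open Scope classical_set_scope.
Local Open Scope ring_scope.

Definition boundary (T : topologicalType) (A : set T) : set T :=
  closure A `\` interior A.

Section Dynamics.
Variable R : realType.
Implicit Types (reg : set (R * R)) (m b : R * R) (I : set int)
  (u : int -> R * R) (dir : rel int).

Definition line b m : set (R * R) :=
  range (fun t : R => (b.1 + t * m.1, b.2 + t * m.2)).

(* For a bounded convex region and m != 0, the set given to xget is a singleton
   as soon as the line through the boundary point b meets the interior. *)
Definition antipode reg m b : R * R :=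
  if `[< line b m `&` interior reg = set0 >] then b
  else xget b [set c | (line b m `&` boundary reg) c /\ c <> b].

(* A sequence indexed by an integer interval I is a total function u on int,
   whose values outside I are irrelevant; r n selects the move applied to u n. *)
Definition trajectory reg m1 m2 I u : Prop :=
  [/\ I !=set0,
      is_interval I,
      forall n, I n -> boundary reg (u n)
    & exists r : int -> bool,
        (forall n, r (n + 1) = ~~ r n) /\
        (forall n, I n -> I (n + 1) ->
           u (n + 1) = antipode reg (if r n then m1 else m2) (u n) /\
           u (n + 1) <> u n)].

Definition extended_trajectory reg m1 m2 I u : Prop :=
  trajectory reg m1 m2 I u /\
  forall J v, trajectory reg m1 m2 J v ->
    I `<=` J -> (forall n, I n -> v n = u n) -> J = I.

(* Extended trajectories through b differ only by shifting and reversing the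
   indices, so at most one set X satisfies this. *)
Definition is_orbit_of reg m1 m2 b (X : set (R * R)) : Prop :=
  exists I u, [/\ extended_trajectory reg m1 m2 I u, (u @` I) b & X = u @` I].

Definition has_slope m (s : R) : Prop := m.1 != 0 /\ m.2 / m.1 = s.

Definition unit_square : set (R * R) := `[0, 1]%classic `*` `[0, 1]%classic.

Definition corners : set (R * R) := [set 0; 1] `*` [set 0; 1].

(* The direction dir is <=%R for increasing indices, >=%R for decreasing ones. *)
Definition stops_in dir I u (C : set (R * R)) : Prop :=
  exists n, [/\ I n, forall k, I k -> dir k n & C (u n)].

(* This set is empty when I is bounded in the direction dir. *)
Definition limit_set dir I u : set (R * R) :=
  \bigcap_(N in [set: int]) closure (u @` [set n | I n /\ dir N n]).

Definition orbitO (m1 m2 : R) : set (R * R) :=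
  [set ((m1 - 1) / (m1 + m2), 0); (1, m1 * (1 + m2) / (m1 + m2));
       ((1 + m2) / (m1 + m2), 1); (0, m2 * (1 - m1) / (m1 + m2))].

End Dynamics.

Arguments unit_square R : clear implicits.
Arguments corners R : clear implicits.

(* Main.v *)
Require Import Defs.
From HB Require Import structures.
From mathcomp Require Import all_boot all_order all_algebra.
From mathcomp Require Import all_classical all_reals all_analysis.
From mathcomp Require Import zify ring lra.
Import Order.TTheory GRing.Theory Num.Theory.
Import numFieldNormedType.Exports.
Local Open Scope classical_set_scope.
Local Open Scope ring_scope.

Set Implicit Arguments.
Unset Strict Implicit.
Unset Printing Implicit Defensive.

(* Cut the boundary of the square into its four sides, each parametrized by
   [t] in [0, 1) counterclockwise.  A move of slope [m1] sends the parameter [t]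
   of a horizontal side to [m1 * (1 - t)] on the next side, and a move of slope
   [m2] does the same on vertical sides with factor [- 1 / m2]: in such a
   contracting state the trajectory runs counterclockwise forever and approaches
   the orbit of the fixed parameters geometrically.  In the other states
   (horizontal side and move [m2], or vertical side and move [m1]) the motion
   either follows this contraction backwards, which moves it away from the orbit
   geometrically and so cannot last, or falls into a contracting state, or stops
   at a corner.  Both directions are alike since the antipode maps are
   involutions, and a trajectory that starts at a corner starts in a contracting
   state, so no trajectory stops at both ends. *)

(** * Interiors and closedness of products *)

Lemma interior_setX (S T : topologicalType) (A : set S) (B : set T) :
  interior (A `*` B) = interior A `*` interior B.
Proof.
apply/seteqP; split => [p|p [pA pB]]; last by exists (A, B).
case=> -[P Q] /= [pP pQ] PQ; split.
  apply: filterS pP => x Px.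
  by have [] := PQ (x, p.2) (conj Px (nbhs_singleton pQ)).
apply: filterS pQ => y Qy.
by have [] := PQ (p.1, y) (conj (nbhs_singleton pP) Qy).
Qed.

Lemma closed_setX (S T : topologicalType) (A : set S) (B : set T) :
  closed A -> closed B -> closed (A `*` B).
Proof.
move=> cA cB; rewrite -[_ `*` _]/(fst @^-1` A `&` snd @^-1` B).
by apply: closedI; apply: closed_comp => // x _; 
  [exact: cvg_fst | exact: cvg_snd].
Qed.

(** * Chords of the square and the antipode maps *)

Section Chords.
Variable R : realType.
Implicit Types (p q s b c v : R * R) (m : R).

Definition in_square p := (0 <= p.1 <= 1) && (0 <= p.2 <= 1).

Definition on_edge p :=
  in_square p && [|| p.1 == 0, p.1 == 1, p.2 == 0 | p.2 == 1].

Lemma interior_squareE p :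
  interior (unit_square R) p <-> 0 < p.1 < 1 /\ 0 < p.2 < 1.
Proof.
rewrite /unit_square interior_setX !interior_itv.
by split=> -[]; rewrite /= !in_itv /= => ? ?; split.
Qed.

Lemma boundary_squareE p : boundary (unit_square R) p <-> on_edge p.
Proof.
rewrite /boundary -(closure_id _).1; last first.
  by apply: closed_setX; exact: interval_closed.
rewrite /on_edge /in_square; split.
  case=> -[]; rewrite /= !in_itv /= => p1 p2 /interior_squareE np.
  rewrite p1 p2 /=; apply: contra_notT np; rewrite !negb_or => /and4P[].
  by rewrite !lt_neqAle -![_ == 1]eq_sym -![_ == 0]eq_sym; lra.
case/andP=> /andP[p1 p2] pe; split; first by split; rewrite /= in_itv.
by move/interior_squareE; move: pe => /or4P[] /eqP ->; lra.
Qed.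

(** The graph of an antipode map away from its fixed points, in a form visibly symmetric in [b] and
    [c]; see [antipodeP]. *)
Definition chord m b c :=
  [/\ on_edge b, on_edge c, b <> c & c.2 - b.2 = m * (c.1 - b.1)].

Lemma chordC m b c : chord m b c -> chord m c b.
Proof. by case=> eb ec bc sl; split=> //; [exact: nesym | lra]. Qed.

(** Since [m] is nonzero, both coordinates are strictly monotone along the line, so those of [q] lie
    strictly between numbers of [0, 1]. *)
Lemma edge_not_between m p q s : m != 0 ->
  in_square p -> on_edge q -> in_square s ->
  q.2 - p.2 = m * (q.1 - p.1) -> s.2 - q.2 = m * (s.1 - q.1) ->
  p.1 < q.1 < s.1 -> False.
Proof.
rewrite /on_edge /in_square => m0 /andP[p1 p2] /andP[_ qe] /andP[s1 s2].
move=> pq qs /andP[lpq lqs].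
have [m_gt0|m_le0] := ltP 0 m.
  have : 0 < m * (q.1 - p.1) by rewrite mulr_gt0 ?subr_gt0.
  have : 0 < m * (s.1 - q.1) by rewrite mulr_gt0 ?subr_gt0.
  by case/or4P: qe => /eqP qe; lra.
have m_lt0 : m < 0 by rewrite lt_neqAle m0.
have : m * (q.1 - p.1) < 0 by rewrite nmulr_rlt0 ?subr_gt0.
have : m * (s.1 - q.1) < 0 by rewrite nmulr_rlt0 ?subr_gt0.
by case/or4P: qe => /eqP qe; lra.
Qed.

(* The middle one of three collinear points would be interior to the square. *)
Lemma chord_inj m b c c' : m != 0 -> chord m b c -> chord m b c' -> c = c'.
Proof.
move=> m0 [eb ec bc sc] [_ ec' bc' sc'].
case/andP: (eb) (ec) (ec') => sb _ /andP[sq _] /andP[sq' _].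
have x_eq p q : q.2 - p.2 = m * (q.1 - p.1) -> p.1 = q.1 -> p = q.
  move=> sl e1; move: sl; rewrite e1 subrr mulr0 => /subr0_eq e2.
  by rewrite [p]surjective_pairing e1 -e2 -surjective_pairing.
apply: contrapT => cc'.
have {}bc : b.1 != c.1 by apply: contra_notN bc => /eqP; exact: x_eq.
have {}bc' : b.1 != c'.1 by apply: contra_notN bc' => /eqP; exact: x_eq.
have s' : c'.2 - c.2 = m * (c'.1 - c.1) by lra.
have {}cc' : c.1 != c'.1 by apply: contra_notN cc' => /eqP; exact: x_eq.
have no := @edge_not_between m.
case/orP: (lt_total bc) => l1; case/orP: (lt_total bc') => l2;
  case/orP: (lt_total cc') => l3; try lra.
- by apply: (no b c c') => //; lra.
- by apply: (no b c' c) => //; lra.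
- by apply: (no c' b c) => //; lra.
- by apply: (no c b c') => //; lra.
- by apply: (no c c' b) => //; lra.
- by apply: (no c' c b) => //; lra.
Qed.

Lemma line_slope m v b c :
  has_slope v m -> line b v c -> c.2 - b.2 = m * (c.1 - b.1).
Proof. by case=> v0 <- [t _ <-] /=; field. Qed.

Lemma chord_line m v b c : has_slope v m -> chord m b c -> line b v c.
Proof.
case=> v0 <- [_ _ _ sl]; exists ((c.1 - b.1) / v.1) => //=.
rewrite divfK // subrKC [c in RHS]surjective_pairing; congr pair.
by rewrite mulrAC -mulrA mulrC -sl subrKC.
Qed.

Lemma antipodeP m v b c : has_slope v m -> m != 0 -> on_edge b ->
  (c = antipode (unit_square R) v b /\ c <> b) <-> chord m b c.
Proof.
move=> sv m0 eb; split.
  rewrite /antipode; case: ifP => [_ [-> //]|_].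
  set S := [set c | _]; have [exS|S0] := pselect (exists x, S x); last first.
    (* Without a second boundary point, [xget] returns its default [b], which [c <> b] rules out. *)
    by rewrite xgetPN => [[->]|x xS] //; apply: S0; exists x.
  case=> cE cb; have : S c by rewrite cE; exact: xgetPex.
  case=> -[lc /boundary_squareE ec] _; split=> //; first exact: nesym.
  exact: line_slope lc.
move=> ch; have [_ ec bc sl] := ch; split; last exact: nesym.
rewrite /antipode asboolF; last first.
  (* The midpoint of the chord is interior to the square, because the ends differ in both
     coordinates. *)
  move=> L0; pose p := ((b.1 + c.1) / 2, (b.2 + c.2) / 2).
  suff : set0 p by [].
  rewrite -L0; split.
    have [t _ tc] := chord_line sv ch.
    by exists (t / 2) => //; rewrite /p -tc /=; congr pair; lra.
  move: eb ec; rewrite /on_edge /in_square => /andP[sb eb] /andP[sc ec].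
  have d1 : b.1 != c.1.
    apply: contra_notN bc => /eqP e1; move: sl.
    rewrite e1 subrr mulr0 => /subr0_eq e2.
    by rewrite [b]surjective_pairing e1 -e2 -surjective_pairing.
  have d2 : b.2 != c.2.
    apply/eqP => e2; move: sl; rewrite e2 subrr => /esym/eqP.
    by rewrite mulf_eq0 (negPf m0) subr_eq0 eq_sym (negPf d1).
  move: d1 d2; rewrite !neq_lt => d1 d2.
  by apply/interior_squareE; rewrite /p /=; lra.
apply/esym/xget_unique.
  by split; [split; [exact: chord_line ch | exact/boundary_squareE] | exact: nesym].
move=> y [[ly /boundary_squareE ey] yb].
apply: (@chord_inj m b) => //; split=> //; first exact: nesym.
exact: line_slope ly.
Qed.

End Chords.

(** * Counterclockwise parametrization of the four sides *)

Section Sides.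
Variables (R : realType) (m1 m2 : R).
Hypotheses (hm1 : 0 < m1 < 1) (hm2 : m2 < -1).
Implicit Types (p b c : R * R) (r h : bool) (t : R).

Definition slope r := if r then m1 else m2.

Definition shrink r := if r then m1 else - m2^-1.

(* The four sides, each without its final corner, are run through
   counterclockwise; [r] tells the horizontal ones from the vertical ones. *)
Definition side r h t : R * R :=
  match r, h with
  | true, false => (t, 0)
  | false, false => (1, t)
  | true, true => (1 - t, 1)
  | false, true => (0, 1 - t)
  end.

(** The two parameters that the maps sending [t] to [shrink r * (1 - t)] exchange, as [fixptN]
    shows. *)
Definition fixpt r :=
  if r then (m1 - 1) / (m1 + m2) else m1 * (1 + m2) / (m1 + m2).

Lemma slope_neq0 r : slope r != 0.
Proof. by case: r => /=; apply/eqP; move: hm1 hm2; lra. Qed.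

Lemma m2_shrink : m2 * shrink false = -1.
Proof. by rewrite /= mulrN divff //; exact: (slope_neq0 false). Qed.

Lemma shrink_itv r : 0 < shrink r < 1.
Proof.
by case: r => //; move: hm2 m2_shrink; move: (shrink false) => a l e;
  apply/andP; split; nra.
Qed.

Lemma fixpt_itv r : 0 < fixpt r < 1.
Proof.
have d0 : m1 + m2 != 0 by apply/eqP; move: hm1 hm2; lra.
have e1 : (m1 + m2) * fixpt true = m1 - 1 by rewrite /=; field.
have e2 : (m1 + m2) * fixpt false = m1 * (1 + m2) by rewrite /=; field.
move: hm1 hm2 e1 e2; case: r; move: (fixpt true) (fixpt false) => x y l1 l2 e1 e2;
  apply/andP; split; nra.
Qed.

Lemma fixptN r : fixpt (~~ r) = shrink r * (1 - fixpt r).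
Proof.
have d0 : m1 + m2 != 0 by apply/eqP; move: hm1 hm2; lra.
have e0 := slope_neq0 false.
by case: r => /=; field; rewrite ?d0 ?e0.
Qed.

(** The map is affine with linear coefficient [- shrink r] and sends one fixed parameter to the
    other. Being an equality, this also measures the expansion of a move run backwards. *)
Lemma shrink_dev r t :
  `|shrink r * (1 - t) - fixpt (~~ r)| = shrink r * `|t - fixpt r|.
Proof.
have /andP[r0 _] := shrink_itv r.
rewrite fixptN -mulrBr normrM gtr0_norm // distrC; congr (_ * `|_|); lra.
Qed.

Lemma orbitOE p : orbitO m1 m2 p <-> exists r h, p = side r h (fixpt r).
Proof.
have d0 : m1 + m2 != 0 by apply/eqP; move: hm1 hm2; lra.
have e1 : (1 + m2) / (m1 + m2) = 1 - fixpt true by rewrite /=; field.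
have e2 : m2 * (1 - m1) / (m1 + m2) = 1 - fixpt false by rewrite /=; field.
rewrite /orbitO e1 e2; split.
  by case=> [[[]|]|] ->; [exists true, false | exists false, false
                        | exists true, true | exists false, true].
by move=> [[] [[] ->]]; [left; right | do 3 left | right | left; left; right].
Qed.

Lemma side_on_edge r h t : 0 <= t <= 1 -> on_edge (side r h t).
Proof.
by rewrite /on_edge /in_square; case: r h => -[] /= ?;
  rewrite ?eqxx ?orbT ?andbT; lra.
Qed.

Lemma side_inj r h h' t t' : 0 <= t < 1 -> 0 <= t' < 1 ->
  side r h t = side r h' t' -> h = h' /\ t = t'.
Proof.
by case: r h h' => -[] [] /= ? ? [] *; first [split=> //; lra | exfalso; lra].
Qed.

Lemma side_surj p : on_edge p -> exists r h t, 0 <= t < 1 /\ p = side r h t.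
Proof.
case: p => x y; rewrite /on_edge /in_square /= => /andP[/andP[hx hy]].
case/or4P=> /eqP e; move: hx hy; rewrite {}e => hx hy.
- have [->|y0] := eqVneq y 0; first by exists true, false, 0; split=> //; lra.
  exists false, true, (1 - y); rewrite /= subKr; split=> //.
  by move: y0; rewrite neq_lt; lra.
- have [->|y0] := eqVneq y 1.
    by exists true, true, 0; rewrite /= subr0; split=> //; lra.
  by exists false, false, y; split=> //; move: y0; rewrite neq_lt; lra.
- have [->|x0] := eqVneq x 1; first by exists false, false, 0; split=> //; lra.
  by exists true, false, x; split=> //; move: x0; rewrite neq_lt; lra.
- have [->|x0] := eqVneq x 0.
    by exists false, true, 0; rewrite /= subr0; split=> //; lra.
  exists true, true, (1 - x); rewrite /= subKr; split=> //.
  by move: x0; rewrite neq_lt; lra.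
Qed.

Lemma side0_corner r h : corners R (side r h 0).
Proof. by rewrite /corners; case: r h => -[]; split=> /=; rewrite ?subr0; tauto. Qed.

Lemma side_ball r h t t' e : 0 < e -> `|t - t'| < e ->
  ball (side r h t) e (side r h t').
Proof.
move=> e0 tt'; have ballR (x y : R) : `|x - y| < e -> ball x e y by [].
by case: r h => -[]; split; apply: ballR => /=; move: tt'; rewrite !ltr_norml; lra.
Qed.

(** A corner belongs only to the side it starts, so every boundary point, corners included, is
    contracting for exactly one value of [r]. *)
Definition contracting r b := exists h t, 0 <= t < 1 /\ b = side r h t.

Lemma contractingN r b : on_edge b -> ~ contracting r b -> contracting (~~ r) b.
Proof.
case/side_surj => r' [h] [t] [t01 ->] nc.
have -> : ~~ r = r' by move: nc; case: r r' => -[] // []; exists h, t.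
by exists h, t.
Qed.

(** The chord cuts off the corner that ends the side: it is the hypotenuse of a right triangle with
    legs [1 - t] and [shrink r * (1 - t)]. Counterclockwise, [h] flips exactly on leaving a vertical
    side, whence [h (+) ~~ r]. *)
Lemma chord_side r h t : 0 <= t < 1 -> chord (slope r) (side r h t)
  (side (~~ r) (h (+) ~~ r) (shrink r * (1 - t))).
Proof.
move=> t01; have a01 := shrink_itv r; have m2a := m2_shrink.
split; [by apply: side_on_edge; lra | by apply: side_on_edge; nra | |].
  by case: r h {m2a a01} => -[] /= [] *; lra.
case: r {a01}; first by case: h => /=; lra.
have {m2a} : m2 * shrink false * (1 - t) = - (1 - t) by rewrite m2a mulN1r.
by move: (shrink false) => a e; case: h => /=; lra.
Qed.

Lemma chord_from_side r h t c : 0 <= t < 1 -> chord (slope r) (side r h t) c ->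
  c = side (~~ r) (h (+) ~~ r) (shrink r * (1 - t)).
Proof.
move=> t01 ch; exact: chord_inj (slope_neq0 r) ch (chord_side r h t01).
Qed.

(** The chord is a contracting one, or a contracting one run backwards to the preceding side, or it
    crosses to the opposite side. *)
Lemma chord_from_noncorner r b : on_edge b -> ~ corners R b ->
  exists c, chord (slope r) b c.
Proof.
move=> eb nb; have [[h [t [t01 ->]]]|nc] := pselect (contracting r b).
  by eexists; exact: chord_side.
have [h [t [t01 bE]]] := contractingN eb nc.
have t0 : 0 < t.
  rewrite lt_neqAle eq_sym; case/andP: t01 => -> _; rewrite andbT.
  by apply: contra_notN nb => /eqP t0; rewrite bE t0; exact: side0_corner.
have /andP[a0 a1] := shrink_itv r; have [ta|ta] := leP t (shrink r).
  (* The preimage of [t] under the contraction from the preceding side; [t > 0] keeps it off the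
     final corner. *)
  have s01 : 0 <= 1 - t / shrink r < 1.
    rewrite ltrBlDr ltrDl divr_gt0 // andbT subr_ge0.
    by rewrite ler_pdivrMr // mul1r.
  exists (side r (h (+) ~~ r) (1 - t / shrink r)); apply: chordC.
  have := chord_side r (h (+) ~~ r) s01.
  by rewrite -addbA addbb addbF subKr [shrink r * _]mulrC divfK ?gt_eqF // -bE.
(* Crossing the unit width shifts the point by [shrink r]; opposite sides run in opposite
   directions, whence [1 - t]. *)
exists (side (~~ r) (~~ h) (1 - t + shrink r)); rewrite bE.
have m2a := m2_shrink.
split; [by apply: side_on_edge; lra | by apply: side_on_edge; lra | |].
  by case: r h {bE nc m2a} a0 a1 ta => -[] /= ? ? ? [] *; lra.
case: r {bE nc a0 a1 ta}; first by case: h => /=; lra.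
by move: (shrink false) m2a => a e; case: h => /=; lra.
Qed.

End Sides.

(** * One-sided chord sequences and their convergence *)

Section Sequences.
Variables (R : realType) (m1 m2 : R).
Hypotheses (hm1 : 0 < m1 < 1) (hm2 : m2 < -1).
Implicit Types (w : nat -> R * R) (r h : nat -> bool).

Local Notation slope := (slope m1 m2).
Local Notation shrink := (shrink m1 m2).
Local Notation fixpt := (fixpt m1 m2).
Local Notation orbit := (orbitO m1 m2).

Definition alternating r := forall n, r n.+1 = ~~ r n.

Definition chord_seq r w :=
  alternating r /\ forall n, chord (slope (r n)) (w n) (w n.+1).

Lemma chord_seq_shift r w N : chord_seq r w ->
  chord_seq (fun n => r (N + n)%N) (fun n => w (N + n)%N).
Proof. by case=> rN ch; split=> n; rewrite addnS. Qed.

Definition max_shrink := Num.max m1 (- m2^-1).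

Lemma max_shrink_itv : 0 <= max_shrink < 1.
Proof.
have /andP[a0 a1] := shrink_itv hm1 hm2 false.
by rewrite gt_max a1 le_max (ltW a0) orbT andbT; case/andP: hm1.
Qed.

Lemma shrink_le_max b : shrink b <= max_shrink.
Proof. by case: b; rewrite le_max lexx ?orbT. Qed.

Lemma expr_max_shrink_lt (e : R) : 0 < e ->
  exists N, forall n, (N <= n)%N -> max_shrink ^+ n < e.
Proof.
move=> e0; have /andP[q0 q1] := max_shrink_itv.
have /cvgrPdist_lt/(_ e e0)[N _ NP] : max_shrink ^+ n @[n --> \oo] --> 0.
  by apply: cvg_expr; rewrite ger0_norm.
by exists N => n /NP; rewrite sub0r normrN ger0_norm // exprn_ge0.
Qed.

Lemma fixpt_dist_le1 b t : 0 <= t < 1 -> `|t - fixpt b| <= 1.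
Proof.
by move=> t01; have := fixpt_itv hm1 hm2 b; rewrite ler_norml; lra.
Qed.

(** A contracting state leads to a contracting state, so [chord_side] describes every step, and by
    [shrink_dev] each step multiplies the deviation by at most [max_shrink]. *)
Lemma contracting_seq r w (h0 : bool) t0 : chord_seq r w ->
  0 <= t0 < 1 -> w 0 = side (r 0) h0 t0 ->
  exists h t, [/\ forall n, h n.+1 = h n (+) ~~ r n,
    forall n, w n = side (r n) (h n) (t n)
    & forall n, `|t n - fixpt (r n)| <= max_shrink ^+ n * `|t0 - fixpt (r 0)|].
Proof.
move=> [rN ch] t01 w0.
pose h n := iteri n (fun i x => x (+) ~~ r i) h0.
pose t n := iteri n (fun i x => shrink (r i) * (1 - x)) t0.
have tw n : 0 <= t n < 1 /\ w n = side (r n) (h n) (t n).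
  elim: n => [//|n [tn wn]]; split.
    rewrite [t _]/=; have := shrink_itv hm1 hm2 (r n).
    move: (shrink _) (t n) tn => a x x01 a01; nra.
  by rewrite rN; apply: chord_from_side => //; rewrite -wn.
exists h, t; split=> // [n|n]; first by have [] := tw n.
elim: n => [|n IHn]; first by rewrite expr0 mul1r.
have /andP[a0 _] := shrink_itv hm1 hm2 (r n).
rewrite rN [t _]/= shrink_dev // exprS -mulrA.
by apply: ler_pM => //; [exact: ltW | exact: shrink_le_max].
Qed.

(** The pair [(r, h)] runs cyclically through its four values, so at most three steps past [N] are
    needed. *)
Lemma side_recurrent r h : alternating r ->
  (forall n, h n.+1 = h n (+) ~~ r n) ->
  forall N (r0 h0 : bool), exists n, [/\ (N <= n)%N, r n = r0 & h n = h0].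
Proof.
move=> rN hN N r0 h0.
suff [k [? ?]] : exists k, r (k + N)%N = r0 /\ h (k + N)%N = h0.
  by exists (k + N)%N; split=> //; exact: leq_addl.
have exE k : r (k + N)%N = r0 -> h (k + N)%N = h0 ->
    exists k, r (k + N)%N = r0 /\ h (k + N)%N = h0 by exists k.
case: (r N =P r0) => er; case: (h N =P h0) => eh; first exact: (exE 0%N).
- by apply: (exE 2%N); rewrite !addSn !add0n !(rN, hN);
    case: (r N) (h N) r0 h0 er eh {exE} => [] [] [] [].
- case rE: (r N) er => er; [apply: (exE 1%N) | apply: (exE 3%N)];
    rewrite !addSn !add0n !(rN, hN) rE;
    by case: (h N) r0 h0 er eh {exE} => [] [] [].
- case rE: (r N) er => er; [apply: (exE 3%N) | apply: (exE 1%N)];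
    rewrite !addSn !add0n !(rN, hN) rE;
    by case: (h N) r0 h0 er eh {exE} => [] [] [].
Qed.

(* Away from the contracting states, the motion is that of a contraction run
   backwards, so that the distance to the orbit grows geometrically. *)
Lemma never_contracting r w : chord_seq r w ->
  (forall n, ~ contracting (r n) (w n)) -> orbit (w 0%N).
Proof.
move=> [rN ch] nc.
have wN n : contracting (~~ r n) (w n).
  by apply: contractingN => //; case: (ch n).
have [h0 [t0 [t01 w0]]] := wN 0%N; apply/orbitOE => //; exists (~~ r 0%N), h0.
suff -> : fixpt (~~ r 0%N) = t0 by [].
(* The initial deviation is at most [max_shrink ^+ n] times the current one, itself at most 1, so it
   must vanish. *)
have dist n : exists (h : bool) (t : R), [/\ 0 <= t < 1, w n = side (~~ r n) h t
    & `|t0 - fixpt (~~ r 0%N)| <= max_shrink ^+ n * `|t - fixpt (~~ r n)|].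
  elim: n => [|n [h [t [tn wn le]]]].
    by exists h0, t0; rewrite expr0 mul1r.
  have [h' [t' [tn' wn']]] := wN n.+1; exists h', t'; split=> //.
  move: wn'; rewrite rN negbK => wn'.
  (* Read backwards, this chord uses the move [r n] from a side of type [r n], so it is the
     contracting chord of [chord_side]. *)
  have := chordC (ch n); rewrite wn' => /(chord_from_side hm1 hm2 tn').
  have /andP[a0 a1] := shrink_itv hm1 hm2 (r n).
  have t''01 : 0 <= shrink (r n) * (1 - t') < 1.
    by move: (shrink _) a0 a1 => a a0 a1; nra.
  rewrite wn => /(side_inj tn t''01)[_ tE]; apply: le_trans le _.
  have /andP[q0 _] := max_shrink_itv.
  rewrite tE shrink_dev // exprSr -mulrA ler_wpM2l ?exprn_ge0 //.
  by rewrite ler_wpM2r // shrink_le_max.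
apply/esym/subr0_eq/normr0_eq0/eqP; rewrite eq_le normr_ge0 andbT leNgt.
apply/negP => /expr_max_shrink_lt[N /(_ N (leqnn N))].
have [h [t [tN _ le]]] := dist N; apply/negP; rewrite -leNgt.
apply: le_trans le _; have /andP[q0 _] := max_shrink_itv.
by rewrite ler_piMr ?exprn_ge0 // fixpt_dist_le1.
Qed.

Lemma eventually_contracting r w : chord_seq r w -> ~ orbit (w 0%N) ->
  exists N, contracting (r N) (w N).
Proof.
move=> rw nO; apply: contrapT => nc; apply: nO; apply: never_contracting rw _.
by move=> n cn; apply: nc; exists n.
Qed.

(** Once contracting, the sequence is compared with the orbit point on the same side, at
    geometrically decaying distance; [side_recurrent] brings it back near each of the four points.
    The two clauses feed [limit_set_le_eq]. *)
Lemma chord_seq_cluster r w : chord_seq r w -> ~ orbit (w 0%N) ->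
  (forall e : R, 0 < e ->
     exists N, forall n, (N <= n)%N -> exists2 o, orbit o & ball o e (w n)) /\
  (forall o (e : R) N, orbit o -> 0 < e ->
     exists2 n, (N <= n)%N & ball o e (w n)).
Proof.
move=> rw nO; have [K [h0 [t0 [t01 w0]]]] := eventually_contracting rw nO.
have rwK := chord_seq_shift K rw.
have := contracting_seq (h0 := h0) rwK t01; rewrite addn0 => /(_ w0).
move=> [h [t [hN wE tE]]].
have q_ge0 n : 0 <= max_shrink ^+ n.
  by apply: exprn_ge0; case/andP: max_shrink_itv.
have near e : 0 < e -> exists N, forall n, (N <= n)%N ->
    ball (side (r (K + n)) (h n) (fixpt (r (K + n)))) e (w (K + n)%N).
  move=> e0; have [N NP] := expr_max_shrink_lt e0; exists N => n /NP qn.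
  rewrite wE; apply: side_ball => //; rewrite distrC.
  apply: le_lt_trans (tE n) _; apply: le_lt_trans qn.
  by rewrite ler_piMr // fixpt_dist_le1.
split=> [e e0|o e N /(orbitOE hm1 hm2)[r1 [h1 ->]] e0].
  have [N NP] := near e e0; exists (K + N)%N => n Nn.
  have Kn : (K <= n)%N by rewrite (leq_trans _ Nn) // leq_addr.
  have := NP (n - K)%N; rewrite subnKC // => nP.
  eexists; last by apply: nP; rewrite leq_subRL.
  by apply/orbitOE => //; eexists; eexists.
have [N' NP] := near e e0.
have [n [nN rn hn]] := side_recurrent rwK.1 hN (maxn N N') r1 h1.
exists (K + n)%N; first
  by rewrite (leq_trans _ (leq_addl _ _)) // (leq_trans _ nN) // leq_maxl.
by rewrite -hn -rn; apply: NP; rewrite (leq_trans _ nN) // leq_maxr.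
Qed.

(** The initial deviation is zero, so the bound of [contracting_seq] keeps it zero, and all four
    sides are visited. *)
Lemma chord_seq_orbit r w (h0 : bool) : chord_seq r w ->
  w 0%N = side (r 0%N) h0 (fixpt (r 0%N)) -> range w = orbit.
Proof.
move=> rw w0; have t01 : 0 <= fixpt (r 0%N) < 1.
  by case/andP: (fixpt_itv hm1 hm2 (r 0%N)) => /ltW -> ->.
have [h [t [hN wE tE]]] := contracting_seq rw t01 w0.
have {}wE n : w n = side (r n) (h n) (fixpt (r n)).
  rewrite wE; congr side; apply/subr0_eq/normr0_eq0/eqP.
  by rewrite eq_le normr_ge0 andbT (le_trans (tE n)) // subrr normr0 mulr0.
apply/seteqP; split=> [_ [n _ <-]|_ /(orbitOE hm1 hm2)[r1 [h1 ->]]].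
  by apply/orbitOE => //; exists (r n), (h n).
have [n [_ <- <-]] := side_recurrent rw.1 hN 0%N r1 h1.
by exists n.
Qed.

End Sequences.

(** * Limit sets in the plane *)

(** The first condition puts the limit set in the closure of [O]; the second gives the reverse
    inclusion. *)
Lemma limit_set_le_eq (R : realType) (I : set int) (u : int -> R * R)
    (O : set (R * R)) : closed O ->
  (forall e : R, 0 < e -> exists N, forall n, I n -> N <= n ->
     exists2 o, O o & ball o e (u n)) ->
  (forall o (e : R) N, O o -> 0 < e ->
     exists n, [/\ I n, N <= n & ball o e (u n)]) ->
  limit_set <=%R I u = O.
Proof.
move=> cO near_O visits; apply/seteqP; split=> [p lp|o Oo N _].
  apply: cO => B /nbhs_ballP[e /= e0 eB].
  have e20 : 0 < e / 2 by rewrite divr_gt0.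
  have [N NP] := near_O _ e20.
  have [_ [[n [In Nn] <-] pn]] := lp N Logic.I _ (nbhsx_ballx p _ e20).
  have [q Oq qb] := NP n In Nn; exists q; split=> //; apply: eB.
  exact: ball_splitl pn qb.
move=> B /nbhs_ballP[e /= e0 eB]; have [n [In Nn ob]] := visits o e N Oo e0.
by exists (u n); split; [exists n | exact: eB].
Qed.

Lemma closed_finite (R : realType) (A : set (R * R)) : finite_set A -> closed A.
Proof.
apply: (accessible_finite_set_closed.1 _).
by apply: hausdorff_accessible; exact: norm_hausdorff.
Qed.

(** * Chord families over integer intervals: extension and time reversal *)

Section Chord_families.
Variables (R : realType) (m1 m2 : R).
Implicit Types (r : int -> bool) (I J : set int) (u v : int -> R * R) (n : int).

Local Notation slope := (slope m1 m2).

Record chords r I u : Prop := Chords {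
  chords_neq0 : I !=set0;
  chords_itv : is_interval I;
  chords_edge : forall n, I n -> on_edge (u n);
  chords_alt : forall n, r (n + 1) = ~~ r n;
  chordsP : forall n, I n -> I (n + 1) -> chord (slope (r n)) (u n) (u (n + 1))
}.

Definition maximal_chords r I u := chords r I u /\
  forall J v, (exists r', chords r' J v) ->
    I `<=` J -> (forall n, I n -> v n = u n) -> J = I.

(** The reversed step from [n] to [n + 1] is the original step from [- n - 1] to [- n], hence the
    shift by one. *)
Definition rev_moves r n := r (- n - 1).
Definition rev_dom I : set int := [set n | I (- n)].
Definition rev_pts u n := u (- n).

Lemma rev_domK : involutive rev_dom.
Proof. by move=> I; apply/funext => n; rewrite /rev_dom /= opprK. Qed.

Lemma rev_pts_image I u : rev_pts u @` rev_dom I = u @` I.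
Proof.
apply/seteqP; split=> [_ [n In <-]|_ [n In <-]]; first by exists (- n).
by exists (- n); rewrite /rev_dom /rev_pts /= opprK.
Qed.

Lemma chords_rev r I u :
  chords r I u -> chords (rev_moves r) (rev_dom I) (rev_pts u).
Proof.
case=> -[n0 In0] Ii ue rN ch; split.
- by exists (- n0); rewrite /rev_dom /= opprK.
- by move=> x y Ix Iy z xyz; apply: (Ii _ _ Iy Ix); lia.
- by move=> n /ue.
- move=> n; rewrite /rev_moves -[in RHS](subrK 1 (- n - 1)) rN negbK.
  by congr r; lia.
- move=> n; rewrite /rev_dom /rev_pts /rev_moves /= => In In1; apply: chordC.
  have e1 : - (n + 1) = - n - 1 by lia.
  by rewrite e1 in In1 *; have := ch (- n - 1) In1; rewrite subrK; apply.
Qed.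

(** Reversal is involutive, so an extension of the reversed family reverses to an extension of the
    original. *)
Lemma maximal_chords_rev r I u : maximal_chords r I u ->
  maximal_chords (rev_moves r) (rev_dom I) (rev_pts u).
Proof.
move=> [ch mx]; split; first exact: chords_rev.
move=> J v [r' ch'] IJ vu; rewrite -[J]rev_domK; congr rev_dom.
apply: (mx _ (rev_pts v)) => [|n In|n In].
- by exists (rev_moves r'); exact: chords_rev.
- by apply: IJ; rewrite /rev_dom /= opprK.
- by rewrite /rev_pts vu /rev_pts ?opprK // /rev_dom /= opprK.
Qed.

(** Otherwise [n] is the last index, and placing [c] at [n + 1] extends the family, against
    maximality. *)
Lemma maximal_chords_next r I u n c : maximal_chords r I u -> I n ->
  chord (slope (r n)) (u n) c -> I (n + 1).
Proof.
move=> [[I0 Ii ue rN ch] mx] In nc; apply: contrapT => nI1.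
have gtI k : I k -> k < n + 1.
  move=> Ik; rewrite ltNge; apply/negP => nk; apply: nI1.
  by apply: (Ii n k) => //; lia.
pose J := I `|` [set n + 1].
pose v k := if k == n + 1 then c else u k.
have vI k : I k -> v k = u k by move=> /gtI k1; rewrite /v lt_eqF.
suff JI : J = I by apply: nI1; rewrite -JI; right.
apply: (mx J v) => //; last by left.
exists r; split=> //.
- by exists n; left.
- move=> x y [Ix|->] [Iy|->] z xyz.
  + by left; apply: (Ii x y).
  + have [->|zn] := eqVneq z (n + 1); first by right.
    by left; apply: (Ii x n) => //; lia.
  + by have := gtI _ Iy; lia.
  + by right=> /=; lia.
- move=> k [Ik|->]; first by rewrite vI //; exact: ue.
  by rewrite /v eqxx; case: nc.
- move=> k [Ik|->] [Ik1|].
  + by rewrite !vI //; exact: ch.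
  + move=> /= /addIr kn; rewrite kn in Ik *; rewrite vI //.
    by rewrite /v eqxx.
  + by have := gtI _ Ik1; lia.
  + by move=> /= e; lia.
Qed.

Lemma maximal_chords_prev r I u n c : maximal_chords r I u -> I n ->
  chord (slope (r (n - 1))) (u n) c -> I (n - 1).
Proof.
move=> mx In nc; have := @maximal_chords_next _ _ _ (- n) c
  (maximal_chords_rev mx).
rewrite /rev_dom /rev_pts /rev_moves /= !opprK opprD opprK.
exact.
Qed.

Definition unbounded_up I := forall n, I n -> I (n + 1).

Lemma unbounded_upD I n : unbounded_up I -> I n -> forall k : nat, I (n + k%:Z).
Proof.
move=> up In; elim=> [|k IHk]; first by rewrite addr0.
by rewrite -addn1 PoszD addrA; exact: up.
Qed.

Lemma chords_seq r I u n : chords r I u -> unbounded_up I -> I n ->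
  chord_seq m1 m2 (fun k => r (n + k%:Z)) (fun k => u (n + k%:Z)).
Proof.
move=> [_ _ _ rN ch] up In; have SE (k : nat) : n + k.+1%:Z = n + k%:Z + 1 by lia.
split=> k; rewrite SE; first exact: rN.
by apply: ch; rewrite -?SE; exact: unbounded_upD.
Qed.

Lemma limit_set_rev I u :
  limit_set >=%R I u = limit_set <=%R (rev_dom I) (rev_pts u).
Proof.
have E N : u @` [set n | I n /\ N >= n] =
    rev_pts u @` [set n | rev_dom I n /\ - N <= n].
  apply/seteqP; split=> [_ [n [In Nn] <-]|_ [n [In Nn] <-]].
    by exists (- n); rewrite /rev_dom /rev_pts /= ?opprK //; split=> //; lia.
  by exists (- n) => //; split=> //=; lia.
apply/seteqP; split=> p lp N _ /=.
  by have := lp (- N) Logic.I; rewrite /= E opprK.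
by rewrite -/(>=%R N) E; exact: lp.
Qed.

Lemma stops_in_rev I u C :
  stops_in <=%R (rev_dom I) (rev_pts u) C -> stops_in >=%R I u C.
Proof.
move=> [n [In nmax Cn]]; exists (- n); split=> // k Ik.
have : - k <= n by apply: nmax; rewrite /rev_dom /= opprK.
by rewrite /=; lia.
Qed.

End Chord_families.

(** * Orbits and limit sets of extended trajectories *)

Section Dynamics.
Variables (R : realType) (m1 m2 : R).
Hypotheses (hm1 : 0 < m1 < 1) (hm2 : m2 < -1).
Implicit Types (r : int -> bool) (I J : set int) (u v : int -> R * R) (n : int).

Local Notation slope := (slope m1 m2).
Local Notation fixpt := (fixpt m1 m2).
Local Notation orbit := (orbitO m1 m2).
Local Notation chords := (chords m1 m2).
Local Notation maximal_chords := (maximal_chords m1 m2).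

Lemma trajectoryE (v1 v2 : R * R) I u :
  has_slope v1 m1 -> has_slope v2 m2 ->
  trajectory (unit_square R) v1 v2 I u <-> exists r, chords r I u.
Proof.
move=> hv1 hv2.
have sv b : has_slope (if b then v1 else v2) (slope b) by case: b.
have s0 := slope_neq0 hm1 hm2.
split=> [[I0 Ii ub [r [rN tr]]]|[r [I0 Ii ub rN tr]]].
  exists r; split=> // [n /ub/boundary_squareE //|n In In1].
  by apply/(antipodeP _ (sv (r n)) (s0 _)); [exact/boundary_squareE/ub | exact: tr].
split=> // [n /ub/boundary_squareE //|]; exists r; split=> // n In In1.
by apply/(antipodeP _ (sv (r n)) (s0 _)); [exact: ub | exact: tr].
Qed.

Lemma extended_trajectoryE (v1 v2 : R * R) I u :
  has_slope v1 m1 -> has_slope v2 m2 ->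
  extended_trajectory (unit_square R) v1 v2 I u <-> exists r, maximal_chords r I u.
Proof.
move=> hv1 hv2; have trE := fun J v => @trajectoryE v1 v2 J v hv1 hv2.
split=> [[/trE[r ch] mx]|[r [ch mx]]].
  by exists r; split=> // J v /trE; exact: mx.
by split=> [|J v /trE]; [apply/trE; exists r | exact: mx].
Qed.

Lemma finite_orbitO : finite_set orbit.
Proof. by rewrite /orbitO !finite_setU; do !split; exact: finite_set1. Qed.

Lemma limit_set_up r I u : maximal_chords r I u ->
  u @` I `&` orbit = set0 -> unbounded_up I -> limit_set <=%R I u = orbit.
Proof.
move=> [ch _] dO up; have [n0 In0] := chords_neq0 ch.
have nO : ~ orbit (u (n0 + 0%:Z)).
  rewrite addr0 => On; suff : set0 (u n0) by [].
  by rewrite -dO; split=> //; exists n0.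
have [near_O visits] := chord_seq_cluster hm1 hm2 (chords_seq ch up In0) nO.
apply: limit_set_le_eq.
- by apply: closed_finite; exact: finite_orbitO.
- move=> e /near_O[N NP]; exists (n0 + N%:Z) => n _ Nn.
  have -> : n = n0 + `|n - n0|%N%:Z by lia.
  by apply: NP; lia.
- move=> o e N Oo /(visits o e `|N - n0|%N Oo)[k Nk ok].
  by exists (n0 + k%:Z); split=> //; [exact: unbounded_upD | lia].
Qed.

(** If the indices are not unbounded, there is a last one; off the corners, [chord_from_noncorner]
    would prolong the family there. *)
Lemma stops_or_converges r I u : maximal_chords r I u ->
  u @` I `&` orbit = set0 ->
  stops_in <=%R I u (corners R) \/ limit_set <=%R I u = orbit.
Proof.
move=> mx dO; have [up|] := pselect (unbounded_up I).
  by right; exact: limit_set_up mx dO up.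
move=> /existsNP[n /not_implyP[In nI1]]; left.
have [[_ Ii ue _ _] _] := mx; exists n; split=> //.
  move=> k Ik; rewrite leNgt; apply/negP => nk; apply: nI1.
  by apply: (Ii n k) => //; lia.
apply: contrapT => nc; apply: nI1.
have [c] := chord_from_noncorner hm1 hm2 (r n) (ue _ In) nc.
exact: maximal_chords_next.
Qed.

(** At a point of the orbit one move is contracting and leads to the next point counterclockwise;
    the other runs such a chord backwards, to the preceding point. *)
Lemma orbitO_chord b p : orbit p -> exists2 c, orbit c & chord (slope b) p c.
Proof.
have f01 a : 0 <= fixpt a < 1.
  by case/andP: (fixpt_itv hm1 hm2 a) => /ltW -> ->.
case/(orbitOE hm1 hm2) => a [h ->]; have [<-|/negPf ab] := eqVneq a b.
  exists (side (~~ a) (h (+) ~~ a) (fixpt (~~ a))).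
    by apply/orbitOE => //; eexists; eexists.
  by rewrite fixptN //; exact: chord_side.
have {ab} -> : a = ~~ b by case: a b ab => [] [].
exists (side b (h (+) ~~ b) (fixpt b)).
  by apply/orbitOE => //; eexists; eexists.
apply: chordC; have := chord_side hm1 hm2 b (h (+) ~~ b) (f01 b).
by rewrite -addbA addbb addbF -fixptN.
Qed.

Lemma orbitO_up r I u n : maximal_chords r I u -> I n -> orbit (u n) ->
  forall k : nat, I (n + k%:Z) /\ orbit (u (n + k%:Z)).
Proof.
move=> mx In On; elim=> [|k [Ik Ok]]; first by rewrite addr0.
rewrite -addn1 PoszD addrA.
have [c Oc cc] := orbitO_chord (r (n + k%:Z)) Ok.
have Ik1 := maximal_chords_next mx Ik cc; split=> //.
by rewrite (chord_inj (slope_neq0 hm1 hm2 _) (chordsP mx.1 Ik Ik1) cc).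
Qed.

(** By [orbitO_chord] neither move stops on the orbit or leaves it; the past is the future of the
    reversed family. *)
Lemma orbitO_everywhere r I u n : maximal_chords r I u -> I n -> orbit (u n) ->
  forall k, I k /\ orbit (u k).
Proof.
move=> mx In On k; have [nk|kn] := leP n k.
  by have := orbitO_up mx In On `|k - n|%N; congr (I _ /\ orbit (u _)); lia.
have := @orbitO_up _ _ _ (- n) (maximal_chords_rev mx).
rewrite /rev_dom /rev_pts /= opprK => /(_ In On `|k - n|%N).
by congr (I _ /\ orbit (u _)); lia.
Qed.

Lemma orbitO_sub r I u n (h : bool) : maximal_chords r I u -> I n ->
  u n = side (r n) h (fixpt (r n)) -> orbit `<=` u @` I.
Proof.
move=> mx In un; have On : orbit (u n) by apply/orbitOE => //; exists (r n), h.
have all := orbitO_everywhere mx In On.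
have up : unbounded_up I by move=> k _; exact: (all _).1.
have := chord_seq_orbit hm1 hm2 (h0 := h) (chords_seq mx.1 up In).
rewrite addr0 => /(_ un) <- _ [k _ <-].
by exists (n + k%:Z) => //; exact: (all _).1.
Qed.

Lemma image_orbitO r I u n : maximal_chords r I u -> I n -> orbit (u n) ->
  u @` I = orbit.
Proof.
move=> mx In On; apply/seteqP; split=> [_ [k _ <-]|].
  by have [] := orbitO_everywhere mx In On k.
have [a [h un]] := (orbitOE hm1 hm2 _).1 On.
have [ar|/negPf ar] := eqVneq a (r n).
  by apply: (orbitO_sub (h := h) mx In); rewrite un ar.
(* The move at [n] is not the contracting one, so the preceding move [r (n - 1)] is, and the
   reversed family is contracting at this point. *)
rewrite -rev_pts_image; apply: (@orbitO_sub (rev_moves r) _ _ (- n) h).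
- exact: maximal_chords_rev.
- by rewrite /rev_dom /= opprK.
- have -> : rev_moves r (- n) = a.
    have := chords_alt mx.1 (n - 1); rewrite subrK /rev_moves opprK.
    by move: ar {un}; case: a (r n) (r (n - 1)) => [] [] [].
  by rewrite /rev_pts opprK.
Qed.

Lemma contracting_up r I u n : maximal_chords r I u -> I n ->
  contracting (r n) (u n) -> I (n + 1) /\ contracting (r (n + 1)) (u (n + 1)).
Proof.
move=> mx In [h [t [t01 un]]].
have cc := chord_side hm1 hm2 (r n) h t01; rewrite -un in cc.
have In1 := maximal_chords_next mx In cc; split=> //.
rewrite (chord_inj (slope_neq0 hm1 hm2 _) (chordsP mx.1 In In1) cc).
rewrite (chords_alt mx.1); eexists; eexists; split; last by [].
have := shrink_itv hm1 hm2 (r n); move: (shrink _ _ _) => a a01; nra.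
Qed.

(** A family with a first index starts in a contracting state, and contracting states never stop. *)
Lemma unbounded_up_or_down r I u : maximal_chords r I u ->
  unbounded_up I \/ unbounded_up (rev_dom I).
Proof.
move=> mx; have [[_ Ii ue rN _] _] := mx.
have [|] := pselect (unbounded_up (rev_dom I)); first by right.
move=> /existsNP[n' /not_implyP[]]; rewrite /rev_dom /= opprD.
move: (- n') => {n'} n In nI1; left.
(* Otherwise the state is contracting for [r (n - 1)], and [chord_side] prolongs the family to
   [n - 1]. *)
have cn : contracting (r n) (u n).
  apply: contrapT => /(contractingN (ue _ In)).
  have := rN (n - 1); rewrite subrK => ->; rewrite negbK => -[h [t [t01 un]]].
  apply: nI1; apply: (maximal_chords_prev mx In).
  by rewrite un; exact: chord_side.
have all (k : nat) : I (n + k%:Z) /\ contracting (r (n + k%:Z)) (u (n + k%:Z)).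
  elim: k => [|k [Ik ck]]; first by rewrite addr0.
  by rewrite -addn1 PoszD addrA; exact: contracting_up.
move=> k Ik; have [nk|kn] := leP n k.
  by have [+ _] := all `|k - n|.+1%N; congr I; lia.
by case: nI1; apply: (Ii k n) => //; lia.
Qed.

(** A finite image is closed, so it contains the limit set in an unbounded direction; that set is
    the whole orbit, which the image avoids. *)
Lemma infinite_image r I u : maximal_chords r I u ->
  u @` I `&` orbit = set0 -> ~ finite_set (u @` I).
Proof.
wlog up : r I u / unbounded_up I.
  move=> H mx dO; have [up|up] := unbounded_up_or_down mx; first exact: H mx dO.
  by rewrite -rev_pts_image; apply: H up (maximal_chords_rev mx) _;
    rewrite rev_pts_image.
move=> mx dO fin; have L := limit_set_up mx dO up.
have [p Op] : orbit !=set0 by eexists; do 3 left.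
suff : set0 p by [].
rewrite -dO; split=> //; apply: (closed_finite fin).
move: Op; rewrite -L => /(_ 0 Logic.I); apply: closure_subset.
by move=> _ [n [In _] <-]; exists n.
Qed.

Lemma orbitO_is_orbit : exists r u, maximal_chords r setT u /\ orbit (u 0).
Proof.
(* The residue of [n] modulo 4 numbers the sides counterclockwise from the bottom: [r] has period 2
   and [h] period 4. *)
pose r (n : int) := (n %% 2)%Z == 0.
pose h (n : int) := 2 <= (n %% 4)%Z.
have rN n : r (n + 1) = ~~ r n by rewrite /r; lia.
have hN n : h (n + 1) = h n (+) ~~ r n by rewrite /r /h; lia.
have f01 a : 0 <= fixpt a < 1.
  by case/andP: (fixpt_itv hm1 hm2 a) => /ltW -> ->.
exists r, (fun n => side (r n) (h n) (fixpt (r n))); split; last first.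
  by apply/orbitOE => //; eexists; eexists.
split; last by move=> J v _ TJ _; apply/seteqP.
split=> //; first by exists 0.
  by move=> n _; apply: side_on_edge; case/andP: (f01 (r n)) => -> /ltW ->.
by move=> n _ _; rewrite rN hN fixptN //; exact: chord_side.
Qed.

End Dynamics.

Theorem theorem6p7 (R : realType) (v1 v2 : R * R) (m1 m2 : R)
    (hv1 : has_slope v1 m1) (hv2 : has_slope v2 m2)
    (hm1 : 0 < m1 < 1) (hm2 : m2 < -1) :
  [set X | (exists2 b, boundary (unit_square R) b &
              is_orbit_of (unit_square R) v1 v2 b X) /\ finite_set X]
    = [set orbitO m1 m2] /\
  (forall (I : set int) (u : int -> R * R),
     extended_trajectory (unit_square R) v1 v2 I u ->
     u @` I `&` orbitO m1 m2 = set0 ->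
     (stops_in <=%R I u (corners R) \/ limit_set <=%R I u = orbitO m1 m2) /\
     (stops_in >=%R I u (corners R) \/ limit_set >=%R I u = orbitO m1 m2)).
Proof.
have extE I u := extended_trajectoryE hm1 hm2 I u hv1 hv2.
split; last first.
  move=> I u /extE[r mx] dO; split; first exact: (stops_or_converges hm1 hm2 mx dO).
  (* The decreasing direction is the increasing one of the reversed family. *)
  have := maximal_chords_rev mx; rewrite limit_set_rev.
  move=> /(stops_or_converges hm1 hm2); rewrite rev_pts_image => /(_ dO)[|->].
    by left; exact: stops_in_rev.
  by right.
apply/seteqP; split=> [X [[b _ [I [u [/extE[r mx] _ ->]]]] fin]|_ ->] /=.
  (* An orbit that avoids [orbitO] is infinite, and one that meets it equals it. *)
  have [dO|/set0P[_ [[n In <-] On]]] := eqVneq (u @` I `&` orbitO m1 m2) set0.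
    by case: (infinite_image hm1 hm2 mx dO).
  exact: (image_orbitO hm1 hm2 mx In On).
split; last exact: finite_orbitO.
have [r [u [mx u0]]] := orbitO_is_orbit hm1 hm2.
exists (u 0); first by apply/boundary_squareE; exact: (chords_edge mx.1).
exists setT, u; split; [by apply/extE; exists r | by exists 0 |].
by rewrite (image_orbitO hm1 hm2 mx _ u0).
Qed.
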